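(* Suppose the sensor topology graph $\mathcal{G}=(\mathcal{N},\mathcal{E})$ is undirected and generically globally rigid (Assumption 1). Let $\{\boldsymbol{z}[k]\},\{\tilde{\boldsymbol{z}}[k]\}$ be generated by the distributed algorithm $$\tilde{\boldsymbol{z}}[k]=\Pi_{\boldsymbol{\varXi}}\big[\boldsymbol{z}[k]-\beta\boldsymbol{F}(\boldsymbol{z}[k])\big],\qquad \boldsymbol{z}[k+1]=\Pi_{\boldsymbol{\varXi}}\big[\boldsymbol{z}[k]-\beta\boldsymbol{F}(\tilde{\boldsymbol{z}}[k])\big],$$ with step size $\beta>0$ satisfying $\beta L<1$, and let $\Upsilon$ be the set of fixed points of this algorithm. Then there exists $\boldsymbol{z}^{\Diamond}\in\Upsilon$ such that $$\lim_{k\to\infty}\tilde{\boldsymbol{z}}[k]=\lim_{k\to\infty}\boldsymbol{z}[k]=\boldsymbol{z}^{\Diamond}.$$ Moreover, if the convergent point $\boldsymbol{z}^{\Diamond}=(\boldsymbol{x}^{\Diamond},\boldsymbol{\sigma}^{\Diamond})$ satisfies $$\sigma_{ij}^{s_i\Diamond}=2\left(\|x_i^{\Diamond}-x_j^{\Diamond}\|^2-d_{ij}^2\right)=0,\qquad \sigma_{il}^{a_i\Diamond}=2\left(\|x_i^{\Diamond}-a_l\|^2-e_{il}^2\right)=0$$ for all $i\in\mathcal{N}_s$, $j\in\mathcal{N}_s^i$, $l\in\mathcal{N}_a^i$, then $\boldsymbol{x}^{\Diamond}$ is the Nash equilibrium of the game $G$.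
   Context: Sensor network. Let $n\in\{2,3\}$. There are $N$ non-anchor nodes $\mathcal{N}_s=\{1,\dots,N\}$ with unknown true positions $x_i^{\star}\in\mathbb{R}^n$ and $M$ anchor nodes $\mathcal{N}_a=\{N+1,\dots,N+M\}$ with known true positions $a_l=x_l^{\star}\in\mathbb{R}^n$. Set $\mathcal{N}=\mathcal{N}_s\cup\mathcal{N}_a$. With a sensing range $R_s>0$, $\mathcal{E}=\mathcal{E}_{ss}\cup\mathcal{E}_{as}\cup\mathcal{E}_{aa}$, where $\mathcal{E}_{ss}$ is the set of (undirected) pairs of distinct non-anchor nodes $i,j$ with $\|x_i^{\star}-x_j^{\star}\|\le R_s$, $\mathcal{E}_{as}$ is the set of pairs $(i,l)\in\mathcal{N}_s\times\mathcal{N}_a$ with $\|x_i^{\star}-a_l\|\le R_s$, and $\mathcal{E}_{aa}$ is the set of all pairs of distinct anchors. $\mathcal{N}_s^i=\{j:(i,j)\in\mathcal{E}_{ss}\}$ and $\mathcal{N}_a^i=\{l:(i,l)\in\mathcal{E}_{as}\}$. Measurements are noise-free: $d_{ij}=\|x_i^{\star}-x_j^{\star}\|$ for $(i,j)\in\mathcal{E}_{ss}$ and $e_{il}=\|x_i^{\star}-a_l\|$ for $(i,l)\in\mathcal{E}_{as}$. Write $\boldsymbol{x}=\operatorname{col}\{x_1,\dots,x_N\}\in\mathbb{R}^{nN}$, $\boldsymbol{x}_{-i}$ for $\boldsymbol{x}$ with $x_i$ removed, and $\boldsymbol{x}^{\star}=\operatorname{col}\{x_1^{\star},\dots,x_N^{\star}\}$.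 Game $G$. Player $i\in\mathcal{N}_s$ chooses $x_i\in\Omega_i$, where $\Omega_i\subseteq\mathbb{R}^n$ is convex and compact, to minimize $J_i(x_i,\boldsymbol{x}_{-i})=\sum_{j\in\mathcal{N}_s^i}(\|x_i-x_j\|^2-d_{ij}^2)^2+\sum_{l\in\mathcal{N}_a^i}(\|x_i-a_l\|^2-e_{il}^2)^2$; $\boldsymbol{\Omega}=\prod_{i=1}^N\Omega_i$. A Nash equilibrium is $\boldsymbol{x}^{\Diamond}\in\boldsymbol{\Omega}$ with $J_i(x_i^{\Diamond},\boldsymbol{x}_{-i}^{\Diamond})\le J_i(x_i,\boldsymbol{x}_{-i}^{\Diamond})$ for all $i\in\mathcal{N}_s$, $x_i\in\Omega_i$. Rigidity. An $n$-dimensional framework is a graph with an assignment of a point of $\mathbb{R}^n$ to each node; it is generic if the set of all coordinates of its points is algebraically independent over the rationals. A framework is globally rigid if every framework on the same graph with the same edge lengths has the same distances between all pairs of nodes. A graph is generically globally rigid if every generic framework of it in $\mathbb{R}^n$ is globally rigid. Standing fact recalled by the paper: under Assumption 1, the problem of finding $x_1,\dots,x_N\in\mathbb{R}^n$ with $\|x_i-x_j\|=d_{ij}$ on $\mathcal{E}_{ss}$ and $\|x_i-a_l\|=e_{il}$ on $\mathcal{E}_{as}$ has the unique solution $\boldsymbol{x}^{\star}$. Distributed algorithm. Fix a constant $W>0$. Each $i\in\mathcal{N}_s$ holds $\sigma_i=\operatorname{col}\{(\sigma_{ij}^{s_i})_{j\in\mathcal{N}_s^i},(\sigma_{il}^{a_i})_{l\in\mathcal{N}_a^i}\}\in\mathscr{E}_i^{+}=[0,W]^{q_i}$,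 $q_i=|\mathcal{N}_s^i|+|\mathcal{N}_a^i|$ (so for an edge between non-anchors $i,j$ there are two variables, $\sigma_{ij}^{s_i}$ held by $i$ and $\sigma_{ij}^{s_j}$ held by $j$). Let $\boldsymbol{\sigma}=\operatorname{col}\{\sigma_1,\dots,\sigma_N\}$, $\mathscr{E}^{+}=\prod_{i=1}^N\mathscr{E}_i^{+}$, $\boldsymbol{z}=\operatorname{col}\{\boldsymbol{x},\boldsymbol{\sigma}\}$ and $\boldsymbol{\varXi}=\boldsymbol{\Omega}\times\mathscr{E}^{+}$. Player $i$'s local complementary function is $$\varGamma_i=\sum_{j\in\mathcal{N}_s^i}\frac{\sigma_{ij}^{s_i}+\sigma_{ij}^{s_j}}{2}(\|x_i-x_j\|^2-d_{ij}^2)+\sum_{l\in\mathcal{N}_a^i}\sigma_{il}^{a_i}(\|x_i-a_l\|^2-e_{il}^2)-\sum_{j\in\mathcal{N}_s^i}\frac14\Big(\frac{\sigma_{ij}^{s_i}+\sigma_{ij}^{s_j}}{2}\Big)^2-\sum_{l\in\mathcal{N}_a^i}\frac{(\sigma_{il}^{a_i})^2}{4},$$ and $\boldsymbol{F}(\boldsymbol{z})=\operatorname{col}\{\operatorname{col}\{\nabla_{x_i}\varGamma_i\}_{i=1}^N,\operatorname{col}\{-\nabla_{\sigma_i}\varGamma_i\}_{i=1}^N\}$, where $\nabla_{x_i}\varGamma_i=\sum_{j\in\mathcal{N}_s^i}(\sigma_{ij}^{s_i}+\sigma_{ij}^{s_j})(x_i-x_j)+\sum_{l\in\mathcal{N}_a^i}2\sigma_{il}^{a_i}(x_i-a_l)$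 and $\nabla_{\sigma_i}\varGamma_i$ has components $\frac12(\|x_i-x_j\|^2-d_{ij}^2)-\frac18(\sigma_{ij}^{s_i}+\sigma_{ij}^{s_j})$ for $j\in\mathcal{N}_s^i$ and $\|x_i-a_l\|^2-e_{il}^2-\frac12\sigma_{il}^{a_i}$ for $l\in\mathcal{N}_a^i$. $L>0$ is a Lipschitz constant of $\boldsymbol{F}$ over $\boldsymbol{\varXi}$. $\Pi_{\boldsymbol{\varXi}}$ is Euclidean projection. The algorithm is initialized with $\sigma_{ij}^{s_i}=\sigma_{ij}^{s_j}$ for all $(i,j)\in\mathcal{E}_{ss}$. A fixed point is a pair $(\tilde{\boldsymbol{z}},\boldsymbol{z})$ with $\tilde{\boldsymbol{z}}=\Pi_{\boldsymbol{\varXi}}(\boldsymbol{z}-\beta\boldsymbol{F}(\boldsymbol{z}))$ and $\boldsymbol{z}=\Pi_{\boldsymbol{\varXi}}(\boldsymbol{z}-\beta\boldsymbol{F}(\tilde{\boldsymbol{z}}))$; when $\beta L<1$ this is equivalent to $\tilde{\boldsymbol{z}}=\boldsymbol{z}=\Pi_{\boldsymbol{\varXi}}(\boldsymbol{z}-\beta\boldsymbol{F}(\boldsymbol{z}))$, and $\boldsymbol{z}^{\Diamond}\in\Upsilon$ means this last equation holds at $\boldsymbol{z}^{\Diamond}$. *)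

(* Defs.v *)
From HB Require Import structures.
From mathcomp Require Import all_boot all_order all_algebra.
From mathcomp Require Import all_classical all_reals all_analysis.
From mathcomp Require Import ring.
From mathcomp Require mpoly.
Import (canonicals) mpoly.

Set Implicit Arguments.
Unset Strict Implicit.
Unset Printing Implicit Defensive.

Import Order.TTheory GRing.Theory Num.Theory.
Import numFieldNormedType.Exports.

Local Open Scope classical_set_scope.
Local Open Scope ring_scope.

(* The library norm on matrices is the sup norm, so the Euclidean norm of R^n
   (row vectors) is defined here; on 'M_(p, q) this is the Frobenius norm, i.e.
   the Euclidean norm of R^(p * q). *)
Definition enorm (R : realType) (p q : nat) (A : 'M[R]_(p, q)) : R :=
  Num.sqrt (\sum_i \sum_j A i j ^+ 2).

Section Rigidity.
Variables (R : realType) (n : nat) (V : finType).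

(* Algebraic independence over the rationals of the family of all coordinates
   p v c, enumerated as #|V * 'I_n| indeterminates. *)
Definition generic (p : V -> 'rV[R]_n) : Prop :=
  forall P : mpoly.mpoly #|{: V * 'I_n}| rat,
    mpoly.mmap (ratr : rat -> R)
      (fun k => p (enum_val k).1 0 (enum_val k).2) P = 0 ->
    P = 0.

Definition globally_rigid (e : rel V) (p : V -> 'rV[R]_n) : Prop :=
  forall q : V -> 'rV[R]_n,
    (forall u v, e u v -> enorm (q u - q v) = enorm (p u - p v)) ->
    forall u v, enorm (q u - q v) = enorm (p u - p v).

Definition generically_globally_rigid (e : rel V) : Prop :=
  forall p : V -> 'rV[R]_n, generic p -> globally_rigid e p.

End Rigidity.

Record network (R : realType) (n N M : nat) := Network {
  xstar : 'I_N -> 'rV[R]_n;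
  anchor : 'I_M -> 'rV[R]_n;
  sensing_range : R
}.

Section Network.
Variables (R : realType) (n N M : nat) (S : network R n N M).

Definition Ess (i j : 'I_N) : bool :=
  (i != j) && (enorm (xstar S i - xstar S j) <= sensing_range S).

Definition Eas (i : 'I_N) (l : 'I_M) : bool :=
  enorm (xstar S i - anchor S l) <= sensing_range S.

Definition edge : rel ('I_N + 'I_M) := fun u v =>
  match u, v with
  | inl i, inl j => Ess i j
  | inl i, inr l => Eas i l
  | inr l, inl i => Eas i l
  | inr l, inr m => l != m
  end.

Definition dss (i j : 'I_N) : R := enorm (xstar S i - xstar S j).
Definition das (i : 'I_N) (l : 'I_M) : R := enorm (xstar S i - anchor S l).

(* J i y x is J_i(y, x_{-i}): row i of x is not used, because Ess i i is
   false. *)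
Definition J (i : 'I_N) (y : 'rV[R]_n) (x : 'M[R]_(N, n)) : R :=
  \sum_(j | Ess i j) (enorm (y - row j x) ^+ 2 - dss i j ^+ 2) ^+ 2 +
  \sum_(l | Eas i l) (enorm (y - anchor S l) ^+ 2 - das i l ^+ 2) ^+ 2.

Definition Nash_equilibrium (Omega : 'I_N -> set 'rV[R]_n)
    (x : 'M[R]_(N, n)) : Prop :=
  (forall i, Omega i (row i x)) /\
  (forall i y, Omega i y -> J i (row i x) x <= J i y x).

(* z = (x, (s, a)): row i x is x_i, s i j is the variable sigma_{ij}^{s_i} held
   by i (so s j i is sigma_{ij}^{s_j}) and a i l is sigma_{il}^{a_i}.  Entries
   of s and a that do not correspond to an edge are padding: they are zero on
   Xi and F vanishes there, so this is an isometric copy of the space of vectors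
   indexed by the edges only. *)
Local Notation state := ('M[R]_(N, n) * ('M[R]_N * 'M[R]_(N, M)))%type.

Definition pos (z : state) : 'M[R]_(N, n) := z.1.
Definition sigs (z : state) : 'M[R]_N := z.2.1.
Definition siga (z : state) : 'M[R]_(N, M) := z.2.2.

Definition snorm (z : state) : R :=
  Num.sqrt (enorm (pos z) ^+ 2 + enorm (sigs z) ^+ 2 + enorm (siga z) ^+ 2).

Definition Xi (Omega : 'I_N -> set 'rV[R]_n) (W : R) : set state :=
  [set z | [/\ forall i, Omega i (row i (pos z)),
               forall i j, if Ess i j then 0 <= sigs z i j <= W
                           else sigs z i j == 0
             & forall i l, if Eas i l then 0 <= siga z i l <= W
                           else siga z i l == 0]].

Definition Gamma (i : 'I_N) (z : state) : R :=
  \sum_(j | Ess i j) (sigs z i j + sigs z j i) / 2 *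
     (enorm (row i (pos z) - row j (pos z)) ^+ 2 - dss i j ^+ 2) +
  \sum_(l | Eas i l) siga z i l *
     (enorm (row i (pos z) - anchor S l) ^+ 2 - das i l ^+ 2) -
  \sum_(j | Ess i j) 1 / 4 * ((sigs z i j + sigs z j i) / 2) ^+ 2 -
  \sum_(l | Eas i l) siga z i l ^+ 2 / 4.

(* Row i collects the partial derivatives of Gamma i in the coordinates of
   player i; see F_posE, F_sigsE and F_sigaE for the closed forms. *)
Definition F (z : state) : state :=
  (\matrix_(i, c) 'D_((delta_mx i c, (0, 0)) : state) (Gamma i) z,
   (\matrix_(i, j) - 'D_((0, (delta_mx i j, 0)) : state) (Gamma i) z,
    \matrix_(i, l) - 'D_((0, (0, delta_mx i l)) : state) (Gamma i) z)).

Definition lipschitz_enorm (A : set state) (L : R) (f : state -> state) : Prop :=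
  forall z w, A z -> A w -> snorm (f z - f w) <= L * snorm (z - w).

(* p is a Euclidean projection of z on A; it is unique if A is convex and
   exists if A is moreover closed and nonempty. *)
Definition is_projection (A : set state) (z p : state) : Prop :=
  A p /\ forall w, A w -> snorm (z - p) <= snorm (z - w).

Definition Upsilon (A : set state) (beta : R) : set state :=
  [set z | is_projection A (z - beta *: F z) z].

Lemma enorm_sqr (p q : nat) (A : 'M[R]_(p, q)) :
  enorm A ^+ 2 = \sum_i \sum_j A i j ^+ 2.
Proof.
by rewrite sqr_sqrtr// sumr_ge0// => i _; rewrite sumr_ge0// => j _; rewrite sqr_ge0.
Qed.

Lemma enorm_sqr_row (v : 'rV[R]_n) : enorm v ^+ 2 = \sum_j v 0 j ^+ 2.
Proof. by rewrite enorm_sqr big_ord1. Qed.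

Lemma derive_quadratic (f : state -> R) (z v : state) (c d : R) :
  (forall h, f (h *: v + z) = f z + h * c + h ^+ 2 * d) -> 'D_v f z = c.
Proof.
move=> fE; rewrite /derive.
apply: cvg_lim => //.
have -> : (fun h : R => h^-1 *: ((f \o shift z) (h *: v) - f z)) =
          (fun h : R => h^-1 *: (h * c + h ^+ 2 * d)).
  by apply/funext => h /=; rewrite fE; congr (_ *: _); ring.
apply: (@cvg_trans _ ((fun h : R => c + h * d) @ 0^')).
  apply: near_eq_cvg; near=> h.
  have h0 : h != 0 by near: h; exact: nbhs_dnbhs_neq.
  by rewrite /GRing.scale/=; field.
have : (fun h : R => c + h * d) @ 0^' --> c + 0 * d.
  apply: cvgD; first exact: cvg_cst.
  apply: cvgMl; apply: cvg_within_filter; exact: cvg_id.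
by rewrite mul0r addr0.
Unshelve. all: by end_near. Qed.

Lemma enorm_sqr_shift (v : 'rV[R]_n) (h : R) (c : 'I_n) :
  enorm (v + h *: delta_mx 0 c) ^+ 2 =
  enorm v ^+ 2 + h * (2 * v 0 c) + h ^+ 2.
Proof.
rewrite !enorm_sqr_row (bigD1 c)//= [in RHS](bigD1 c)//= !mxE !eqxx/=.
rewrite (eq_bigr (fun j => v 0 j ^+ 2)) => [|j jc]; first by ring.
by rewrite !mxE eqxx (negbTE jc)/= mulr0 addr0.
Qed.

Lemma sum_quadratic (I : finType) (P : pred I) (f g0 g1 g2 : I -> R) (h : R) :
  (forall k, P k -> f k = g0 k + h * g1 k + h ^+ 2 * g2 k) ->
  \sum_(k | P k) f k = \sum_(k | P k) g0 k + h * \sum_(k | P k) g1 k +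
                       h ^+ 2 * \sum_(k | P k) g2 k.
Proof. by move=> fE; rewrite (eq_bigr _ fE) !big_split/= !mulr_sumr. Qed.

Lemma pos_shift h (v z : state) : pos (h *: v + z) = h *: pos v + pos z.
Proof. by []. Qed.

Lemma sigs_shift h (v z : state) : sigs (h *: v + z) = h *: sigs v + sigs z.
Proof. by []. Qed.

Lemma siga_shift h (v z : state) : siga (h *: v + z) = h *: siga v + siga z.
Proof. by []. Qed.

Lemma F_posE (z : state) (i : 'I_N) (c : 'I_n) :
  pos (F z) i c =
  \sum_(j | Ess i j) (sigs z i j + sigs z j i) * (pos z i c - pos z j c) +
  \sum_(l | Eas i l) 2 * siga z i l * (pos z i c - anchor S l 0 c).
Proof.
rewrite /pos /= mxE -/(pos z).
apply: (@derive_quadratic _ _ _ _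
  (\sum_(j | Ess i j) (sigs z i j + sigs z j i) / 2 +
   \sum_(l | Eas i l) siga z i l)) => h.
rewrite /Gamma; set z' := _ + z.
have sE : sigs z' = sigs z by rewrite sigs_shift scaler0 add0r.
have aE : siga z' = siga z by rewrite siga_shift scaler0 add0r.
have xiE : row i (pos z') = row i (pos z) + h *: delta_mx 0 c.
  by apply/rowP => k; rewrite pos_shift !mxE eqxx addrC.
have xjE j : j != i -> row j (pos z') = row j (pos z).
  by move=> /negbTE ji; apply/rowP => k; rewrite pos_shift !mxE ji/= mulr0 add0r.
rewrite sE aE.
rewrite (@sum_quadratic _ (Ess i) _
  (fun j => (sigs z i j + sigs z j i) / 2 *
     (enorm (row i (pos z) - row j (pos z)) ^+ 2 - dss i j ^+ 2))
  (fun j => (sigs z i j + sigs z j i) * (pos z i c - pos z j c))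
  (fun j => (sigs z i j + sigs z j i) / 2) h); last first.
  move=> j /andP[ij _]; rewrite xiE xjE 1?eq_sym// addrAC enorm_sqr_shift !mxE.
  by field.
rewrite (@sum_quadratic _ (Eas i) (fun l => _ * (_ - _))
  (fun l => siga z i l * (enorm (row i (pos z) - anchor S l) ^+ 2 - das i l ^+ 2))
  (fun l => 2 * siga z i l * (pos z i c - anchor S l 0 c))
  (fun l => siga z i l) h); last first.
  by move=> l _; rewrite xiE addrAC enorm_sqr_shift !mxE; ring.
by ring.
Qed.

Lemma F_sigsE (z : state) (i j : 'I_N) :
  sigs (F z) i j = if Ess i j then
    - (1 / 2 * (enorm (row i (pos z) - row j (pos z)) ^+ 2 - dss i j ^+ 2) -
       1 / 8 * (sigs z i j + sigs z j i)) else 0.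
Proof.
rewrite /sigs /= mxE -/(sigs z); set D := (X in - X).
pose r k := enorm (row i (pos z) - row k (pos z)) ^+ 2 - dss i k ^+ 2.
suff -> : D = \sum_(k | Ess i k) (k == j)%:R * (1 / 2 * r k) -
    \sum_(k | Ess i k) (k == j)%:R * (1 / 8 * (sigs z i k + sigs z k i)).
  have sum1 (f : 'I_N -> R) : \sum_(k | Ess i k) (k == j)%:R * f k =
      if Ess i j then f j else 0.
    case: ifPn => ij.
      by rewrite (bigD1 j)//= eqxx mul1r big1 ?addr0// => k /andP[_ /negbTE->]; rewrite mul0r.
    rewrite big1// => k ik; case: eqP => [kj|]; last by rewrite mul0r.
    by rewrite -kj ik in ij.
  by rewrite !sum1; case: ifP => _; rewrite ?subr0 ?oppr0.
rewrite /D.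
apply: (@derive_quadratic _ _ _ _
  (- \sum_(k | Ess i k) (k == j)%:R / 16)) => h.
rewrite /Gamma; set z' := _ + z.
have xE : pos z' = pos z by rewrite pos_shift scaler0 add0r.
have aE : siga z' = siga z by rewrite siga_shift scaler0 add0r.
have sE k : Ess i k -> sigs z' i k + sigs z' k i =
    sigs z i k + sigs z k i + h * (k == j)%:R.
  move=> /andP[ik _].
  by rewrite sigs_shift !mxE eqxx (eq_sym k i) (negbTE ik)/= mulr0 add0r; ring.
have bE k : ((k == j)%:R : R) ^+ 2 = (k == j)%:R by case: eqP; rewrite ?expr1n ?expr0n.
rewrite xE aE.
rewrite (@sum_quadratic _ (Ess i) _
  (fun k => (sigs z i k + sigs z k i) / 2 * r k)
  (fun k => (k == j)%:R * (1 / 2 * r k)) (fun=> 0) h); last first.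
  by move=> k ik; rewrite sE// /r; field.
rewrite (@sum_quadratic _ (Ess i) (fun k => 1 / 4 * _)
  (fun k => 1 / 4 * ((sigs z i k + sigs z k i) / 2) ^+ 2)
  (fun k => (k == j)%:R * (1 / 8 * (sigs z i k + sigs z k i)))
  (fun k => (k == j)%:R / 16) h); last first.
  by move=> k ik; rewrite sE// -[in X in _ + h ^+ 2 * X]bE; field.
by rewrite big1_eq; ring.
Qed.

Lemma F_sigaE (z : state) (i : 'I_N) (l : 'I_M) :
  siga (F z) i l = if Eas i l then
    - (enorm (row i (pos z) - anchor S l) ^+ 2 - das i l ^+ 2 -
       1 / 2 * siga z i l) else 0.
Proof.
rewrite /siga /= mxE -/(siga z); set D := (X in - X).
pose r k := enorm (row i (pos z) - anchor S k) ^+ 2 - das i k ^+ 2.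
suff -> : D = \sum_(k | Eas i k) (k == l)%:R * r k -
    \sum_(k | Eas i k) (k == l)%:R * (1 / 2 * siga z i k).
  have sum1 (f : 'I_M -> R) : \sum_(k | Eas i k) (k == l)%:R * f k =
      if Eas i l then f l else 0.
    case: ifPn => il.
      by rewrite (bigD1 l)//= eqxx mul1r big1 ?addr0// => k /andP[_ /negbTE->]; rewrite mul0r.
    rewrite big1// => k ik; case: eqP => [kl|]; last by rewrite mul0r.
    by rewrite -kl ik in il.
  by rewrite !sum1; case: ifP => _; rewrite ?subr0 ?oppr0.
rewrite /D.
apply: (@derive_quadratic _ _ _ _
  (- \sum_(k | Eas i k) (k == l)%:R / 4)) => h.
rewrite /Gamma; set z' := _ + z.
have xE : pos z' = pos z by rewrite pos_shift scaler0 add0r.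
have sE : sigs z' = sigs z by rewrite sigs_shift scaler0 add0r.
have aE k : siga z' i k = siga z i k + h * (k == l)%:R.
  by rewrite siga_shift !mxE eqxx/= addrC.
have bE k : ((k == l)%:R : R) ^+ 2 = (k == l)%:R by case: eqP; rewrite ?expr1n ?expr0n.
rewrite xE sE.
rewrite (@sum_quadratic _ (Eas i) (fun k => siga z' i k * _)
  (fun k => siga z i k * r k)
  (fun k => (k == l)%:R * r k) (fun=> 0) h); last first.
  by move=> k _; rewrite aE /r; ring.
rewrite (@sum_quadratic _ (Eas i) (fun k => siga z' i k ^+ 2 / 4)
  (fun k => siga z i k ^+ 2 / 4)
  (fun k => (k == l)%:R * (1 / 2 * siga z i k))
  (fun k => (k == l)%:R / 4) h); last first.
  by move=> k _; rewrite aE -[in X in _ + h ^+ 2 * X]bE; field.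
by rewrite big1_eq; ring.
Qed.

End Network.

Notation state R n N M :=
  ('M[R]_(N, n) * ('M[R]_N * 'M[R]_(N, M)))%type (only parsing).

(* Main.v *)
Require Import Defs.
From mathcomp Require Import all_boot all_order all_algebra.
From mathcomp Require Import all_classical all_reals all_analysis.
From mathcomp Require Import ring lra.

Import Order.TTheory GRing.Theory Num.Theory.
Import numFieldNormedType.Exports.

Set Implicit Arguments.
Unset Strict Implicit.
Unset Printing Implicit Defensive.

Local Open Scope classical_set_scope.
Local Open Scope ring_scope.

(** The field F is (grad_x Phi, - grad_sigma Phi) for the saddle function
Phi = sum over the edges of m (|x_i - x_j|^2 - d^2) - m^2 / 4,
where the weight m of an edge between two non-anchors is the mean of its two
dual variables and that of an edge to an anchor is its dual variable.  Phi is
convex in x as long as the weights are nonnegative, and concave in sigma.  Hence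
F is monotone on Xi: in <F u - F v, u - v> every edge, with weights s, t and
position differences X, Y at u and v, contributes
(s + t) |X - Y|^2 + (s - t)^2 / 2 >= 0
([edge_monotone], [F_monotone]).  The algorithm is then Korpelevich's
extragradient method for a monotone Lipschitz field on a convex compact set, and
[extragradient_cvg] proves its convergence in any normed space with a compatible
inner product.

That proof rests on one inequality, [extragradient_step]: for all u in K,
|z_(k+1) - u|^2 <= |z_k - u|^2 - (1 - (beta L)^2) |z_k - zt_k|^2
  - 2 beta <F zt_k, zt_k - u>.
It is used three times.
- Summed over k, with monotonicity, it bounds <F v, w - v> by O(1 / r) for
  every v in K, where w is the mean of the first r points zt_k.  A cluster point
  p of these means satisfies <F v, p - v> <= 0 for all v in K (a Minty point,
  [minty_exists]).  So solutions exist by compactness alone, without a fixed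
  point theorem.
- Applied at a Minty point, it makes |z_k - p| nonincreasing, and the decrease
  controls the gap |z_k - zt_k|, which therefore tends to 0.
- A cluster point zd of z_k is also one of zt_k; passing to the limit in the
  variational inequality that characterises zt_k shows that zd is a fixed point
  of the algorithm.  By monotonicity zd is itself a Minty point, so |z_k - zd|
  is nonincreasing; as it gets arbitrarily small, it tends to 0.

Cluster points are handled with an ultrafilter finer than the neighbourhoods of
infinity, along which every sequence in a compact set converges.

As to equilibria, J_i is a sum of squares; if all the edge residuals vanish at
the limit, then every J_i is 0 there and no player can do better. *)

(** * Compactness through ultrafilters *)

(** Along an ultrafilter on the index set, a whole family of points of a compact
set converges at once; this replaces the extraction of subsequences, and lets
the same filter serve for several sequences. *)
Lemma ultra_cvg_in_compact (I : Type) (U : set_system I)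
    (X : topologicalType) (K : set X) (f : I -> X) :
  UltraFilter U -> compact K -> (\forall i \near U, K (f i)) ->
  exists2 p, K p & f @ U --> p.
Proof.
move=> UU cK UK; have [p [Kp clp]] := cK (f @ U) _ UK.
exists p => // B pB /=; have [//|UnB] := in_ultra_setVsetC (f @^-1` B) UU.
by have [i []] := clp (~` B) B UnB pB.
Qed.

(** Rows converge along an ultrafilter by compactness of each factor, and
convergence of a matrix is convergence of its entries. *)
Lemma compact_rows (R : realType) (m n : nat) (A : 'I_m -> set 'rV[R]_n) :
  (forall i, compact (A i)) ->
  compact [set X : 'M[R]_(m, n) | forall i, A i (row i X)].
Proof.
move=> cA; rewrite compact_ultra => G UG GA.
have /choice[y y_lim] : forall i, exists y, A i y /\ row i X @[X --> G] --> y.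
  move=> i; have [|y Ay cvg_y] := ultra_cvg_in_compact (f := row i) UG (cA i).
    by apply: filterS GA => X; apply.
  by exists y.
exists (\matrix_i y i); split=> /= [i|B [P nbhsP subB]].
  by rewrite rowK; have [] := y_lim i.
apply: (filterS subB); apply: filter_forall => i; apply: filter_forall => j.
have [_ cvg_y] := y_lim i.
have cvg_yj : row i X 0 j @[X --> G] --> y i 0 j.
  by apply: (cvg_comp (row i) (fun v : 'rV_n => v 0 j) cvg_y);
    exact: coord_continuous.
have yP : nbhs (y i 0 j) (P i j) by have := nbhsP i j; rewrite mxE.
have GP : G [set X | P i j (row i X 0 j)] := cvg_yj _ yP.
by apply: filterS GP => X /=; rewrite mxE.
Qed.

(** * Inner products and projections *)

Lemma convex_setP (R : realType) (V : lmodType R)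
    (A : set (convex_lmodType V)) :
  convex_set A <->
  forall (x y : V) (t : R), 0 <= t <= 1 -> A x -> A y ->
    A (t *: x + (1 - t) *: y).
Proof.
split=> [cA x y t /andP[t0 t1] Ax Ay|cA x y t].
  by have := cA x y (Itv01 t0 t1); rewrite !inE; apply.
by rewrite !inE; apply: cA; rewrite ge0 le1.
Qed.

(** The last two fields make the topology of the inner product that of V, whose
own norm may be different: on matrices and pairs it is the sup norm, whereas the
projections of the algorithm are Euclidean. *)
Record inner_product (R : realType) (V : normedModType R) := InnerProduct {
  ip :> V -> V -> R;
  ipC : forall u v, ip u v = ip v u;
  ipDl : forall u v w, ip (u + v) w = ip u w + ip v w;
  ipZl : forall a u w, ip (a *: u) w = a * ip u w;
  sqr_norm_le_ip : forall u, `|u| ^+ 2 <= ip u u;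
  ip_continuous : continuous (fun u : V * V => ip u.1 u.2)
}.

Section InnerProductTheory.
Variables (R : realType) (V : normedModType R) (d : inner_product V).
Implicit Types (u v w p y : V) (K : set V).

Lemma ipDr u v w : d w (u + v) = d w u + d w v.
Proof. by rewrite ipC ipDl !(ipC _ w). Qed.

Lemma ipZr a u w : d w (a *: u) = a * d w u.
Proof. by rewrite ipC ipZl ipC. Qed.

Lemma ipNl u w : d (- u) w = - d u w.
Proof. by rewrite -scaleN1r ipZl mulN1r. Qed.

Lemma ipNr u w : d w (- u) = - d w u.
Proof. by rewrite ipC ipNl ipC. Qed.

Definition ipE := (ipDl, ipDr, ipNl, ipNr, ipZl, ipZr).

Lemma ip_ge0 u : 0 <= d u u.
Proof. by apply: le_trans (sqr_norm_le_ip d u); exact: sqr_ge0. Qed.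

Lemma ip_young u v : 2 * d u v <= d u u + d v v.
Proof. by have := ip_ge0 (u - v); rewrite !ipE (ipC d v u); lra. Qed.

Lemma cvg_ip (I : Type) (G : set_system I) {FG : Filter G} (f g : I -> V) u v :
  f @ G --> u -> g @ G --> v -> d (f i) (g i) @[i --> G] --> d u v.
Proof.
move=> fu gv; apply: (cvg_comp (fun i => (f i, g i)) _ _
  (@ip_continuous _ _ d (u, v))).
exact: cvg_pair.
Qed.

Lemma cvg_ip0P (I : Type) (G : set_system I) {FG : Filter G} (f : I -> V) u :
  f @ G --> u <-> d (f i - u) (f i - u) @[i --> G] --> 0.
Proof.
split=> [fu|fu].
  have fu0 : f i - u @[i --> G] --> 0.
    by rewrite -(subrr u); apply: cvgB => //; exact: cvg_cst.
  have <- : d 0 0 = 0 by rewrite -(scale0r 0) ipZl mul0r.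
  exact: cvg_ip.
apply/cvgrPdist_lt => e e0.
move/cvgr0Pnorm_lt : fu => /(_ _ (exprn_gt0 2 e0)); apply: filterS => i.
rewrite ger0_norm ?ip_ge0// distrC => lt_e.
rewrite -(ltr_pXn2r (n := 2)) ?nnegrE ?normr_ge0 ?(ltW e0)//.
exact: le_lt_trans (sqr_norm_le_ip d _) lt_e.
Qed.

Definition projection_on K y p : Prop :=
  K p /\ forall w, K w -> d (y - p) (y - p) <= d (y - w) (y - w).

(** The variational characterisation of projections on a convex set, used for
the step inequality and, since it is stable under limits, for the limit
point. *)
Lemma projection_onP K y p :
  convex_set (K : set (convex_lmodType V)) ->
  projection_on K y p <-> K p /\ forall w, K w -> d (y - p) (w - p) <= 0.
Proof.
move=> /convex_setP cK; split=> -[Kp prp]; split=> // w Kw; last first.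
  have := prp w Kw; have := ip_ge0 (w - p).
  by rewrite !ipE (ipC d w p) (ipC d w y) (ipC d p y); lra.
(* Moving from p towards w by t changes the squared distance by
   - 2 t a + t ^ 2 b, which is negative at t = a / (a + b) when a > 0. *)
have dist_segment t : 0 <= t <= 1 ->
    2 * t * d (y - p) (w - p) <= t ^+ 2 * d (w - p) (w - p).
  move=> t01; have := prp _ (cK _ _ _ t01 Kw Kp).
  have -> : y - (t *: w + (1 - t) *: p) = (y - p) - t *: (w - p).
    rewrite scalerBr scalerBl scale1r !opprD !opprK -[RHS]addrA.
    by congr (y + _); rewrite addrCA.
  by move: (y - p) (w - p) => e f; rewrite !ipE (ipC d f e); lra.
rewrite leNgt; apply/negP.
move: (d (y - p) _) (d (w - p) _) (ip_ge0 (w - p)) dist_segment.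
move=> a b b0 dist_segment a0; have ab0 : 0 < a + b by rewrite ltr_wpDr.
have t0 : 0 < a / (a + b) by rewrite divr_gt0.
have t1 : a / (a + b) <= 1 by rewrite ler_pdivrMr// mul1r lerDl.
have := dist_segment _ (introT andP (conj (ltW t0) t1)).
have : a / (a + b) * (a + b) = a by rewrite divfK// gt_eqF.
by move: (a / (a + b)) t0 => t t0 tab ds; nra.
Qed.

End InnerProductTheory.

Section MatrixInnerProduct.
Variables (R : realType) (m n : nat).
Implicit Types A B : 'M[R]_(m, n).

Definition mx_ip A B := \sum_i \sum_j A i j * B i j.

Let mx_ipC A B : mx_ip A B = mx_ip B A.
Proof. by apply: eq_bigr => i _; apply: eq_bigr => j _; rewrite mulrC. Qed.

Let mx_ipDl A B C : mx_ip (A + B) C = mx_ip A C + mx_ip B C.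
Proof.
rewrite /mx_ip -big_split; apply: eq_bigr => i _; rewrite -big_split.
by apply: eq_bigr => j _; rewrite mxE mulrDl.
Qed.

Let mx_ipZl a A B : mx_ip (a *: A) B = a * mx_ip A B.
Proof.
rewrite /mx_ip mulr_sumr; apply: eq_bigr => i _; rewrite mulr_sumr.
by apply: eq_bigr => j _; rewrite mxE mulrA.
Qed.

Let sqr_norm_le_mx_ip A : `|A| ^+ 2 <= mx_ip A A.
Proof.
have ip_ge0 i j : 0 <= A i j * A i j by rewrite -expr2 sqr_ge0.
have [->|/mx_norm_neq0[[i j] /= normA]] := eqVneq `|A| 0.
  by rewrite expr0n sumr_ge0// => i _; exact: sumr_ge0.
rewrite [`|A|]normA real_normK ?num_real// expr2 /mx_ip.
rewrite (bigD1 i)//= (bigD1 j)//= -addrA lerDl addr_ge0 ?sumr_ge0//.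
by move=> k _; exact: sumr_ge0.
Qed.

Let mx_ip_continuous : continuous (fun C : 'M[R]_(m, n) * 'M[R]_(m, n) =>
  mx_ip C.1 C.2).
Proof.
move=> C; apply: (cvg_big add_continuous) => i _.
apply: (cvg_big add_continuous) => j _.
have entry_continuous A : B i j @[B --> A] --> A i j by exact: coord_continuous.
by apply: cvgM; [apply: (cvg_comp _ _ cvg_fst (entry_continuous C.1))|
  apply: (cvg_comp _ _ cvg_snd (entry_continuous C.2))].
Qed.

Definition mx_inner_product := InnerProduct mx_ipC mx_ipDl mx_ipZl
  sqr_norm_le_mx_ip mx_ip_continuous.

End MatrixInnerProduct.

Section ProductInnerProduct.
Variables (R : realType) (V W : normedModType R).
Variables (dV : inner_product V) (dW : inner_product W).
Implicit Types u v : V * W.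

Definition pair_ip u v := dV u.1 v.1 + dW u.2 v.2.

Let pair_ipC u v : pair_ip u v = pair_ip v u.
Proof. by rewrite /pair_ip ipC (ipC dW). Qed.

Let pair_ipDl u v w : pair_ip (u + v) w = pair_ip u w + pair_ip v w.
Proof. by rewrite /pair_ip !ipDl addrACA. Qed.

Let pair_ipZl a u v : pair_ip (a *: u) v = a * pair_ip u v.
Proof. by rewrite /pair_ip !ipZl mulrDr. Qed.

Let sqr_norm_le_pair_ip u : `|u| ^+ 2 <= pair_ip u u.
Proof.
have [V0 W0] := (ip_ge0 dV u.1, ip_ge0 dW u.2).
have [Vu Wu] := (sqr_norm_le_ip dV u.1, sqr_norm_le_ip dW u.2).
rewrite prod_normE; case: (leP `|u.1| `|u.2|) => _; rewrite /pair_ip.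
  by rewrite (le_trans Wu)// lerDr.
by rewrite (le_trans Vu)// lerDl.
Qed.

Let pair_ip_continuous : continuous (fun c : (V * W) * (V * W) =>
  pair_ip c.1 c.2).
Proof.
move=> c.
have c1 : c'.1 @[c' --> c] --> c.1 by exact: cvg_fst.
have c2 : c'.2 @[c' --> c] --> c.2 by exact: cvg_snd.
apply: cvgD; apply: cvg_ip.
- exact: (cvg_comp _ _ c1 cvg_fst).
- exact: (cvg_comp _ _ c2 cvg_fst).
- exact: (cvg_comp _ _ c1 cvg_snd).
- exact: (cvg_comp _ _ c2 cvg_snd).
Qed.

Definition pair_inner_product := InnerProduct pair_ipC pair_ipDl pair_ipZl
  sqr_norm_le_pair_ip pair_ip_continuous.

End ProductInnerProduct.

(** * The extragradient method *)

Section Extragradient.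
Variables (R : realType) (V : normedModType R) (d : inner_product V).
Variables (K : set V) (F : V -> V) (L beta : R).
Hypothesis K_convex : convex_set (K : set (convex_lmodType V)).
Hypothesis F_lipschitz : forall u v, K u -> K v ->
  d (F u - F v) (F u - F v) <= L ^+ 2 * d (u - v) (u - v).
Hypothesis beta_gt0 : 0 < beta.

(** Expand |yn - u|^2 around yt.  The inequality of the projection yn at u and
that of yt at yn leave the cross term 2 beta <F y - F yt, yn - yt>, at most
beta^2 |F y - F yt|^2 + |yn - yt|^2 ([ip_young]); the Lipschitz bound turns the
first summand into (beta L)^2 |y - yt|^2 and the second one cancels. *)
Lemma extragradient_step y yt yn u : K y -> K u ->
  projection_on d K (y - beta *: F y) yt ->
  projection_on d K (y - beta *: F yt) yn ->
  d (yn - u) (yn - u) <= d (y - u) (y - u)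
    - (1 - (beta * L) ^+ 2) * d (y - yt) (y - yt)
    - 2 * beta * d (F yt) (yt - u).
Proof.
move=> Ky Ku /(projection_onP _ _ _ K_convex)[Kyt yt_proj].
move=> /(projection_onP _ _ _ K_convex)[Kyn yn_proj].
have := yt_proj _ Kyn; have := yn_proj _ Ku.
have : beta ^+ 2 * d (F y - F yt) (F y - F yt) <=
    (beta * L) ^+ 2 * d (y - yt) (y - yt).
  by rewrite exprMn -[leRHS]mulrA ler_pM2l ?exprn_gt0//; exact: F_lipschitz.
have := ip_young d (beta *: (F y - F yt)) (yn - yt).
rewrite !ipE ?(ipC d yt y, ipC d yn y, ipC d u y, ipC d yn yt, ipC d u yn).
by lra.
Qed.

Hypothesis K_compact : compact K.
Hypothesis F_monotone : forall u v, K u -> K v -> 0 <= d (F u - F v) (u - v).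
Hypothesis betaL_lt1 : (beta * L) ^+ 2 < 1.
Variables z zt : nat -> V.
Hypothesis z0_in : K (z 0%N).
Hypothesis zt_proj : forall k, projection_on d K (z k - beta *: F (z k)) (zt k).
Hypothesis z_proj :
  forall k, projection_on d K (z k - beta *: F (zt k)) (z k.+1).

Let z_in k : K (z k). Proof. by case: k => [//|k]; have [] := z_proj k. Qed.

Let zt_in k : K (zt k). Proof. by have [] := zt_proj k. Qed.

Let q u := d u u.

Let descent k u : K u -> q (z k.+1 - u) <= q (z k - u)
    - (1 - (beta * L) ^+ 2) * q (z k - zt k)
    - 2 * beta * d (F (zt k)) (zt k - u).
Proof. by move=> Ku; apply: extragradient_step. Qed.

Let monotone_bound v w : K v -> K w -> d (F v) (w - v) <= d (F w) (w - v).
Proof. by move=> Kv Kw; have := F_monotone Kw Kv; rewrite ipDl ipNl; lra. Qed.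

Let mean m := m.+1%:R^-1 *: \sum_(k < m.+1) zt k.

Let mean_in m : K (mean m).
Proof.
elim: m => [|m IHm]; first by rewrite /mean big_ord1 invr1 scale1r.
have m0 : m.+1%:R != 0 :> R by rewrite pnatr_eq0.
have m1 : m.+2%:R != 0 :> R by rewrite pnatr_eq0.
have -> : mean m.+1 =
    (m.+1%:R / m.+2%:R) *: mean m + (1 - m.+1%:R / m.+2%:R) *: zt m.+1.
  rewrite /mean big_ord_recr scalerDr/= scalerA mulrAC divff// mul1r.
  congr (_ + _ *: _); apply: (mulIf m1).
  by rewrite mulVf// mulrBl divfK// mul1r -natrB// subSnn.
apply: (iffLR (convex_setP _) K_convex) => //.
by rewrite divr_ge0//= ler_pdivrMr ?ltr0n// mul1r ler_nat.
Qed.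

(* The step inequality telescopes when summed over k, and monotonicity replaces
   F (zt k) by the fixed vector F v, so that the sum is linear in the mean. *)
Let mean_bound m v : K v -> d (F v) (mean m - v) <=
  q (z 0%N - v) / (2 * beta) * harmonic m.
Proof.
move=> Kv.
have sum_bound n : 2 * beta * \sum_(k < n) d (F v) (zt k - v) <=
    q (z 0%N - v) - q (z n - v).
  elim: n => [|n IHn]; first by rewrite big_ord0 mulr0 subrr.
  rewrite big_ord_recr mulrDr/=.
  have := descent n Kv; have := ip_ge0 d (z n - zt n).
  have := ler_wpM2l (mulr_ge0 (ler0n R 2) (ltW beta_gt0))
    (monotone_bound Kv (zt_in n)).
  by rewrite -/(q _); move: betaL_lt1 IHn; nra.
have -> : mean m - v = m.+1%:R^-1 *: \sum_(k < m.+1) (zt k - v).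
  rewrite sumrB scalerBr sumr_const card_ord.
  by rewrite -[v *+ _]scaler_nat scalerA mulVf ?pnatr_eq0// scale1r.
rewrite ipZr mulrC ler_wpM2r ?invr_ge0//.
have -> : d (F v) (\sum_(k < m.+1) (zt k - v)) =
    \sum_(k < m.+1) d (F v) (zt k - v).
  apply: (big_morph (d (F v))) => [? ?|]; first exact: ipDr.
  by rewrite -(scale0r 0) ipZr mul0r.
rewrite ler_pdivlMr ?mulr_gt0// mulrC (le_trans (sum_bound _))//.
by rewrite lerBlDr lerDl; exact: ip_ge0.
Qed.

(** The solutions of the Minty form of the variational inequality.  For a
continuous monotone field they coincide with its solutions, but this form is
affine in p, hence passes to means of points and to their limits. *)
Let minty p := K p /\ forall v, K v -> d (F v) (p - v) <= 0.

Lemma minty_exists : exists p, minty p.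
Proof.
have [U [UU sub_U]] := ultraFilterLemma (@eventually_filter).
have [u Ku mean_u] : exists2 p, K p & mean @ U --> p.
  by apply: ultra_cvg_in_compact => //; exact: nearW mean_in.
exists u; split=> // v Kv.
have bound_0 : q (z 0%N - v) / (2 * beta) * harmonic m @[m --> U] --> 0.
  rewrite -[X in _ --> X](mulr0 (q (z 0%N - v) / (2 * beta))).
  by apply: cvgMr => B /cvg_harmonic /= /sub_U.
apply: (ler_cvg_to (f := fun m => d (F v) (mean m - v)) _ bound_0).
  by apply: cvg_ip; [exact: cvg_cst|apply: cvgB => //; exact: cvg_cst].
by apply: nearW => m; exact: mean_bound.
Qed.

Let minty_descent k p : minty p ->
  (1 - (beta * L) ^+ 2) * q (z k - zt k) <= q (z k - p) - q (z k.+1 - p).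
Proof.
move=> [Kp minty_p]; have := descent k Kp; have := minty_p _ (zt_in k).
have -> : d (F (zt k)) (p - zt k) = - d (F (zt k)) (zt k - p).
  by rewrite -ipNr opprB.
by move: beta_gt0; nra.
Qed.

Let minty_noninc p : minty p -> nonincreasing_seq (fun k => q (z k - p)).
Proof.
move=> minty_p; apply/nonincreasing_seqP => k; rewrite -subr_ge0.
apply: le_trans (minty_descent k minty_p).
by rewrite mulr_ge0 ?ip_ge0// subr_ge0 ltW.
Qed.

Let gap_cvg0 : q (z k - zt k) @[k --> \oo] --> 0.
Proof.
have [u minty_u] := minty_exists; pose a k := q (z k - u).
have cvg_a : cvgn a.
  apply: nonincreasing_is_cvgn; first exact: minty_noninc.
  by exists 0 => _ [k _ <-]; exact: ip_ge0.
have drop0 : (1 - (beta * L) ^+ 2)^-1 * (a k - a k.+1) @[k --> \oo] --> 0.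
  rewrite -[X in _ --> X](mulr0 (1 - (beta * L) ^+ 2)^-1).
  apply: cvgMr; rewrite -[X in _ --> X](subrr (limn a)); apply: cvgB => //.
  by rewrite (cvg_shiftS a).
apply: (squeeze_cvgr _ (cvg_cst 0) drop0); apply: nearW => k.
by rewrite ip_ge0/= ler_pdivlMl ?subr_gt0//; exact: minty_descent.
Qed.

(** Korpelevich's theorem.  Along an ultrafilter the iterates converge to a
fixed point zd; by monotonicity zd is a Minty point, so the distances to zd are
nonincreasing, and this turns convergence along the ultrafilter into
convergence. *)
Theorem extragradient_cvg : exists zd, [/\ K zd,
  projection_on d K (zd - beta *: F zd) zd, zt @ \oo --> zd & z @ \oo --> zd].
Proof.
have [U [UU sub_U]] := ultraFilterLemma (@eventually_filter).
have [zd Kzd z_zd] : exists2 p, K p & z @ U --> p.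
  by apply: ultra_cvg_in_compact => //; exact: nearW z_in.
have gap_cvg (G : set_system nat) : Filter G -> \oo `<=` G ->
    z @ G --> zd -> zt @ G --> zd.
  move=> FG subG zG.
  have zzt : z k - zt k @[k --> G] --> 0.
    apply/(cvg_ip0P d); under eq_fun do rewrite subr0.
    by move=> B /gap_cvg0 /= /subG.
  rewrite -[zd]subr0 (_ : zt = fun k => z k - (z k - zt k)).
    exact: cvgB.
  by apply/funext => k; rewrite subKr.
have zt_zd : zt @ U --> zd by exact: (gap_cvg U _ sub_U z_zd).
have F_zd : (fun k => F (z k)) @ U --> F zd.
  apply/(cvg_ip0P d); move/(cvg_ip0P d) : z_zd => z_zd.
  have bound0 : L ^+ 2 * d (z k - zd) (z k - zd) @[k --> U] --> 0.
    by rewrite -[X in _ --> X](mulr0 (L ^+ 2)); exact: cvgMr.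
  apply: (squeeze_cvgr _ (cvg_cst 0) bound0); apply: nearW => k.
  by rewrite ip_ge0/=; exact: F_lipschitz.
have vi_zd w : K w -> d (zd - beta *: F zd - zd) (w - zd) <= 0.
  move=> Kw.
  apply: (@cvgr_to_le _ U _ _
    (fun k => d (z k - beta *: F (z k) - zt k) (w - zt k))).
    apply: cvg_ip; last by apply: cvgB => //; exact: cvg_cst.
    by do 2 apply: cvgB => //; exact: cvgZr.
  apply: nearW => k.
  by have /(projection_onP _ _ _ K_convex)[_] := zt_proj k; apply.
have minty_zd : minty zd.
  split=> // v Kv; have := vi_zd v Kv; have := F_monotone Kv Kzd.
  rewrite addrAC subrr add0r ipNl ipZl oppr_le0 pmulr_rge0// => mon vi.
  have -> : zd - v = - (v - zd) by rewrite opprB.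
  by move: mon; rewrite ipDl !ipNl ipNr; lra.
have z_cvg : z @ \oo --> zd.
  apply/(cvg_ip0P d); apply/cvgr0Pnorm_lt => e e0.
  move/(cvg_ip0P d)/cvgr0Pnorm_lt : z_zd => /(_ _ e0) /filter_ex[N zN].
  exists N => // k /= Nk; apply: le_lt_trans zN.
  rewrite !ger0_norm ?ip_ge0//.
  exact: minty_noninc.
exists zd; split => //; last exact: (gap_cvg \oo).
by apply/(projection_onP _ _ _ K_convex).
Qed.

End Extragradient.

(** * The field of the sensor network game *)

Lemma enormN (R : realType) (p q : nat) (A : 'M[R]_(p, q)) :
  enorm (- A) = enorm A.
Proof.
by rewrite /enorm; congr Num.sqrt; apply: eq_bigr => i _;
  apply: eq_bigr => j _; rewrite mxE sqrrN.
Qed.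

Lemma enorm_distC (R : realType) (p q : nat) (A B : 'M[R]_(p, q)) :
  enorm (A - B) = enorm (B - A).
Proof. by rewrite -enormN opprB. Qed.

(** Each undirected edge occurs twice in such a sum; only the joint contribution
of its two orientations has a sign. *)
Lemma sym_sum_ge0 (R : numDomainType) (I : finType) (E : rel I)
    (f : I -> I -> R) : symmetric E ->
  (forall i j, E i j -> 0 <= f i j + f j i) ->
  0 <= \sum_i \sum_(j | E i j) f i j.
Proof.
move=> Esym f_ge0; rewrite -(pmulr_rge0 _ (ltr0n R 2)) mulr2n mulrDl mul1r.
rewrite [X in _ + X](exchange_big_dep predT)//= -big_split/=.
apply: sumr_ge0 => i _; under [X in _ + X]eq_bigl do rewrite Esym.
by rewrite -big_split/=; apply: sumr_ge0 => j; exact: f_ge0.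
Qed.

(** Monotonicity of the saddle field of s (|X|^2 - d^2) - s^2 / 4, in the
variables X and s >= 0 of a single edge: the left-hand side is
(s + t) |X - Y|^2 + (s - t)^2 / 2. *)
Lemma edge_monotone (R : realType) (n : nat) (s t : R) (X Y : 'rV[R]_n) :
  0 <= s -> 0 <= t ->
  0 <= \sum_c 2 * (s * X 0 c - t * Y 0 c) * (X 0 c - Y 0 c)
    - (enorm X ^+ 2 - enorm Y ^+ 2 - 1 / 2 * (s - t)) * (s - t).
Proof.
move=> s0 t0; set lhs := (X in 0 <= X).
have -> : lhs = (s + t) * enorm (X - Y) ^+ 2 + (s - t) ^+ 2 / 2.
  have -> : (s + t) * enorm (X - Y) ^+ 2 =
      \sum_c 2 * (s * X 0 c - t * Y 0 c) * (X 0 c - Y 0 c)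
      - (enorm X ^+ 2 - enorm Y ^+ 2) * (s - t).
    rewrite !enorm_sqr_row -sumrB mulr_suml -sumrB mulr_sumr.
    by apply: eq_bigr => c _; rewrite !mxE; ring.
  by rewrite /lhs; field.
apply: addr_ge0; first by rewrite mulr_ge0 ?sqr_ge0 ?addr_ge0.
by rewrite divr_ge0 ?sqr_ge0.
Qed.

Section SensorNetwork.
Variables (R : realType) (n N M : nat) (S : network R n N M).
Variables (Omega : 'I_N -> set 'rV[R]_n) (W : R).
Local Notation state :=
  ('M[R]_(N, n) * ('M[R]_N * 'M[R]_(N, M)))%type.
Implicit Types u v w z y p : state.

Definition state_ip : inner_product state :=
  pair_inner_product (mx_inner_product R N n)
    (pair_inner_product (mx_inner_product R N N) (mx_inner_product R N M)).

Lemma state_ip_snorm u : state_ip u u = snorm u ^+ 2.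
Proof.
rewrite /snorm sqr_sqrtr ?addr_ge0 ?sqr_ge0// !enorm_sqr -addrA.
by congr (_ + (_ + _)); apply: eq_bigr => i _; apply: eq_bigr => j _;
  rewrite expr2.
Qed.

(* Unfolding the inner product by simplification would also unfold F. *)
Lemma state_ipE u v : state_ip u v =
  \sum_i \sum_c pos u i c * pos v i c +
  (\sum_i \sum_j sigs u i j * sigs v i j +
   \sum_i \sum_l siga u i l * siga v i l).
Proof. by []. Qed.

Lemma posB u v i c : pos (u - v) i c = pos u i c - pos v i c.
Proof. by rewrite [LHS]mxE [X in _ + X]mxE. Qed.

Lemma sigsB u v i j : sigs (u - v) i j = sigs u i j - sigs v i j.
Proof. by rewrite [LHS]mxE [X in _ + X]mxE. Qed.

Lemma sigaB u v i l : siga (u - v) i l = siga u i l - siga v i l.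
Proof. by rewrite [LHS]mxE [X in _ + X]mxE. Qed.

Lemma snorm_ge0 u : 0 <= snorm u. Proof. exact: sqrtr_ge0. Qed.

Lemma is_projectionP (K : set state) y p :
  is_projection K y p <-> projection_on state_ip K y p.
Proof.
by split=> -[Kp p_min]; split=> // w /p_min;
  rewrite !state_ip_snorm ler_pXn2r ?nnegrE ?snorm_ge0.
Qed.

Lemma Ess_sym : symmetric (Ess S).
Proof. by move=> i j; rewrite /Ess eq_sym enorm_distC. Qed.

Lemma convex_Xi :
  (forall i, convex_set (Omega i : set (convex_lmodType 'rV[R]_n))) ->
  convex_set (Xi S Omega W : set (convex_lmodType state)).
Proof.
move=> cO; apply/convex_setP => u v t t01 [up us ua] [vp vs va].
have box (a b : R) : 0 <= a <= W -> 0 <= b <= W ->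
    0 <= t * a + (1 - t) * b <= W.
  move: t01 => /andP[t0 t1] /andP[a0 aW] /andP[b0 bW].
  by apply/andP; split; nra.
split=> i => [|j|j].
- rewrite [row i _](_ : _ = t *: row i (pos u) + (1 - t) *: row i (pos v)).
    exact: (iffLR (convex_setP _) (cO i)).
  by apply/rowP => c; rewrite !mxE.
- rewrite /sigs/= !mxE; have := us i j; have := vs i j.
  case: ifP => _; first by move=> *; exact: box.
  by move=> /eqP-> /eqP->; rewrite !mulr0 addr0.
- rewrite /siga/= !mxE; have := ua i j; have := va i j.
  case: ifP => _; first by move=> *; exact: box.
  by move=> /eqP-> /eqP->; rewrite !mulr0 addr0.
Qed.

Lemma compact_entries (m k : nat) (E : 'I_m -> 'I_k -> bool) :
  compact [set X : 'M[R]_(m, k) |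
    forall i j, if E i j then 0 <= X i j <= W else X i j == 0].
Proof.
pose A i j := if E i j then `[0, W]%classic else [set (0 : R)].
have -> : [set X : 'M[R]_(m, k) |
      forall i j, if E i j then 0 <= X i j <= W else X i j == 0] =
    [set X | forall i, [set v : 'rV[R]_k | forall j, A i j (v 0 j)] (row i X)].
  have AP i j x : A i j x <-> if E i j then 0 <= x <= W else x == 0.
    rewrite /A; case: ifP => _; last by split=> /eqP.
    by rewrite /= in_itv.
  by apply/seteqP; split=> X /= XA i j; have := XA i j; rewrite mxE => /AP.
apply: (compact_rows
  (A := fun i => [set v : 'rV[R]_k | forall j, A i j (v 0 j)])) => i.
apply: rV_compact => j; rewrite /A.
by case: ifP => _; [exact: segment_compact|exact: compact_set1].
Qed.

Lemma compact_Xi : (forall i, compact (Omega i)) -> compact (Xi S Omega W).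
Proof.
move=> cO; rewrite (_ : Xi S Omega W =
  [set X : 'M[R]_(N, n) | forall i, Omega i (row i X)] `*`
  ([set X : 'M[R]_N |
     forall i j, if Ess S i j then 0 <= X i j <= W else X i j == 0] `*`
   [set X : 'M[R]_(N, M) |
     forall i j, if Eas S i j then 0 <= X i j <= W else X i j == 0])).
  apply: compact_setX; first exact: compact_rows.
  by apply: compact_setX; exact: compact_entries.
by apply/seteqP; split=> z; [case|case=> ? []].
Qed.

(** Grouping the pairing by edges: player i's end of an edge contributes e i j,
which pairs the forces with the displacement D i of that player only.  Summing
the two ends turns D i into the relative displacement X u i j - X v i j and the
increments of the two dual variables into twice that of their mean m. *)
Lemma F_monotone u v : Xi S Omega W u -> Xi S Omega W v ->
  0 <= state_ip (F S u - F S v) (u - v).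
Proof.
move=> [_ us ua] [_ vs va].
pose m w i j := (sigs w i j + sigs w j i) / 2.
pose X w i j := row i (pos w) - row j (pos w).
pose Z w i l := row i (pos w) - anchor S l.
pose D i : 'rV[R]_n := row i (pos u) - row i (pos v).
pose e i j := \sum_c 2 * (m u i j * X u i j 0 c - m v i j * X v i j 0 c)
    * D i 0 c -
  (1 / 2 * (enorm (X u i j) ^+ 2 - enorm (X v i j) ^+ 2)
   - 1 / 4 * (m u i j - m v i j)) * (sigs u i j - sigs v i j).
pose a i l := \sum_c 2 * (siga u i l * Z u i l 0 c - siga v i l * Z v i l 0 c)
    * D i 0 c -
  (enorm (Z u i l) ^+ 2 - enorm (Z v i l) ^+ 2
   - 1 / 2 * (siga u i l - siga v i l)) * (siga u i l - siga v i l).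
have -> : state_ip (F S u - F S v) (u - v) =
    \sum_i \sum_(j | Ess S i j) e i j + \sum_i \sum_(l | Eas S i l) a i l.
  have posE i : \sum_c pos (F S u - F S v) i c * pos (u - v) i c =
      \sum_(j | Ess S i j) \sum_c
        2 * (m u i j * X u i j 0 c - m v i j * X v i j 0 c) * D i 0 c +
      \sum_(l | Eas S i l) \sum_c
        2 * (siga u i l * Z u i l 0 c - siga v i l * Z v i l 0 c) * D i 0 c.
    rewrite [X in _ = X + _]exchange_big [X in _ = _ + X]exchange_big.
    rewrite -big_split.
    apply: eq_bigr => c _; rewrite [RHS]/= -!mulr_suml -mulrDl.
    have -> : D i 0 c = pos (u - v) i c by rewrite posB !mxE.
    congr (_ * _); rewrite posB !F_posE opprD addrACA -!sumrB.
    by congr (_ + _); apply: eq_bigr => j _; rewrite !mxE /m; field.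
  have sigsE i : \sum_j sigs (F S u - F S v) i j * sigs (u - v) i j =
      \sum_(j | Ess S i j) -
        ((1 / 2 * (enorm (X u i j) ^+ 2 - enorm (X v i j) ^+ 2)
         - 1 / 4 * (m u i j - m v i j)) * (sigs u i j - sigs v i j)).
    rewrite [RHS]big_mkcond; apply: eq_bigr => j _; rewrite !sigsB !F_sigsE.
    by case: ifP => _; [rewrite /m; field|rewrite subrr mul0r].
  have sigaE i : \sum_l siga (F S u - F S v) i l * siga (u - v) i l =
      \sum_(l | Eas S i l) -
        ((enorm (Z u i l) ^+ 2 - enorm (Z v i l) ^+ 2
         - 1 / 2 * (siga u i l - siga v i l)) * (siga u i l - siga v i l)).
    rewrite [RHS]big_mkcond; apply: eq_bigr => l _; rewrite !sigaB !F_sigaE.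
    by case: ifP => _; [field|rewrite subrr mul0r].
  rewrite state_ipE (eq_bigr _ (fun i _ => posE i)).
  rewrite (eq_bigr _ (fun i _ => sigsE i)) (eq_bigr _ (fun i _ => sigaE i)).
  rewrite big_split/= addrACA -!big_split/=.
  by apply: eq_bigr => i _; rewrite -!big_split.
apply: addr_ge0.
  apply: (sym_sum_ge0 Ess_sym) => i j ij.
  have m_ge0 w : (forall i j, if Ess S i j then 0 <= sigs w i j <= W
      else sigs w i j == 0) -> 0 <= m w i j.
    move=> ws; have := ws i j; have := ws j i; rewrite Ess_sym ij.
    by move=> /andP[ji0 _] /andP[ij0 _]; rewrite divr_ge0 ?addr_ge0.
  suff -> : e i j + e j i = \sum_c 2 * (m u i j * X u i j 0 c
        - m v i j * X v i j 0 c) * (X u i j 0 c - X v i j 0 c) -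
      (enorm (X u i j) ^+ 2 - enorm (X v i j) ^+ 2
       - 1 / 2 * (m u i j - m v i j)) * (m u i j - m v i j).
    by apply: edge_monotone; exact: m_ge0.
  have Xji w : X w j i = - X w i j by rewrite /X opprB.
  have mji w : m w j i = m w i j by rewrite /m addrC.
  have -> : \sum_c 2 * (m u i j * X u i j 0 c - m v i j * X v i j 0 c) *
      (X u i j 0 c - X v i j 0 c) =
    \sum_c 2 * (m u i j * X u i j 0 c - m v i j * X v i j 0 c) * D i 0 c +
    \sum_c 2 * (m u i j * X u j i 0 c - m v i j * X v j i 0 c) * D j 0 c.
    by rewrite -big_split/=; apply: eq_bigr => c _; rewrite !mxE; ring.
  by rewrite /e !Xji !mji !enormN /m; field.
apply: sumr_ge0 => i _; apply: sumr_ge0 => l il.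
have [s0 t0] : 0 <= siga u i l /\ 0 <= siga v i l.
  by have := ua i l; have := va i l; rewrite il => /andP[-> _] /andP[-> _].
rewrite /a (eq_bigr (fun c => 2 * (siga u i l * Z u i l 0 c
  - siga v i l * Z v i l 0 c) * (Z u i l 0 c - Z v i l 0 c))).
  exact: edge_monotone.
by move=> c _; rewrite !mxE; ring.
Qed.

Lemma Nash_of_zero_residual (x : 'M[R]_(N, n)) :
  (forall i, Omega i (row i x)) ->
  (forall i j, Ess S i j ->
     enorm (row i x - row j x) ^+ 2 - dss S i j ^+ 2 = 0) ->
  (forall i l, Eas S i l ->
     enorm (row i x - anchor S l) ^+ 2 - das S i l ^+ 2 = 0) ->
  Nash_equilibrium S Omega x.
Proof.
move=> xO xss xas; split=> // i y _.
have -> : J S i (row i x) x = 0.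
  by rewrite /J !big1 ?addr0// => [l il|j ij];
    rewrite ?xss ?xas// expr0n.
by rewrite addr_ge0// sumr_ge0// => k _; rewrite sqr_ge0.
Qed.

End SensorNetwork.

Theorem theorem4 (R : realType) (n N M : nat) (hn : n = 2%N \/ n = 3%N)
    (S : network R n N M) (hRs : 0 < sensing_range S)
    (hundirected : symmetric (edge S))
    (hrigid : generically_globally_rigid R n (edge S))
    (Omega : 'I_N -> set 'rV[R]_n)
    (hconvex : forall i, convex_set (Omega i : set (convex_lmodType 'rV[R]_n)))
    (hcompact : forall i, compact (Omega i))
    (W : R) (hW : 0 < W)
    (L : R) (hL : 0 < L) (hlip : lipschitz_enorm (Xi S Omega W) L (F S))
    (beta : R) (hbeta : 0 < beta) (hbetaL : beta * L < 1)
    (z ztilde : nat -> state R n N M)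
    (hz0 : Xi S Omega W (z 0%N))
    (hsym0 : forall i j, Ess S i j -> sigs (z 0%N) i j = sigs (z 0%N) j i)
    (hztilde : forall k,
      is_projection (Xi S Omega W) (z k - beta *: F S (z k)) (ztilde k))
    (hz : forall k,
      is_projection (Xi S Omega W) (z k - beta *: F S (ztilde k)) (z k.+1)) :
  exists zd : state R n N M,
    [/\ Upsilon S (Xi S Omega W) beta zd,
        ztilde @ \oo --> zd,
        z @ \oo --> zd
      & ((forall i j, Ess S i j ->
            sigs zd i j = 2 * (enorm (row i (pos zd) - row j (pos zd)) ^+ 2
                               - dss S i j ^+ 2) /\
            2 * (enorm (row i (pos zd) - row j (pos zd)) ^+ 2
                 - dss S i j ^+ 2) = 0) ->
         (forall i l, Eas S i l ->
            siga zd i l = 2 * (enorm (row i (pos zd) - anchor S l) ^+ 2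
                               - das S i l ^+ 2) /\
            2 * (enorm (row i (pos zd) - anchor S l) ^+ 2
                 - das S i l ^+ 2) = 0) ->
         Nash_equilibrium S Omega (pos zd))].
Proof.
have projP y p := is_projectionP (Xi S Omega W) y p.
have K_convex := @convex_Xi _ _ _ _ S _ W hconvex.
have F_lipschitz u v : Xi S Omega W u -> Xi S Omega W v ->
    state_ip R n N M (F S u - F S v) (F S u - F S v)
    <= L ^+ 2 * state_ip R n N M (u - v) (u - v).
  move=> Ku Kv; rewrite !state_ip_snorm -exprMn.
  by rewrite ler_pXn2r ?nnegrE ?mulr_ge0 ?snorm_ge0 ?(ltW hL)//; exact: hlip.
have betaL : (beta * L) ^+ 2 < 1 by rewrite expr_lt1// mulr_ge0 ?ltW.
have [zd [Kzd zd_proj zt_zd z_zd]] := extragradient_cvg K_convex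
  F_lipschitz hbeta (compact_Xi hcompact) (@F_monotone _ _ _ _ S Omega W) betaL
  hz0 (fun k => iffLR (projP _ _) (hztilde k))
  (fun k => iffLR (projP _ _) (hz k)).
exists zd; split=> //; first exact/projP.
have half0 (x : R) : 2 * x = 0 -> x = 0.
  by move/eqP; rewrite mulf_eq0 pnatr_eq0 => /eqP.
move=> ss0 as0; apply: Nash_of_zero_residual.
- by have [] := Kzd.
- by move=> i j /ss0[_ /half0].
- by move=> i l /as0[_ /half0].
Qed.
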